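(* Let $R$ be a ring and let $\mathscr{A}$ be a class of $t$-radicals on $R\text{-Mod}$. Then every $\mathscr{A}$-second module is an $\mathscr{A}$-co-first module.
   Context: $R$ is an associative ring with identity; modules are left $R$-modules. A preradical on $R\text{-Mod}$ is a functor $\sigma:R\text{-Mod}\to R\text{-Mod}$ with $\sigma(M)\le M$ for all $M$ and $f(\sigma(M))\le\sigma(N)$ for every homomorphism $f:M\to N$ ($\sigma(f)$ being the restriction of $f$). $\sigma$ is a $t$-radical if $\sigma(M)=\sigma(R)M$ for every module $M$. $\mathbb{T}_\sigma=\{M\mid\sigma(M)=M\}$. Let $\mathscr{A}$ be a class of preradicals and $M$ a nonzero module. $M$ is $\mathscr{A}$-second if for every $\alpha\in\mathscr{A}$, $\alpha(M)=0$ or $\alpha(M)=M$. $M$ is $\mathscr{A}$-co-first if for every $\alpha\in\mathscr{A}$, either $M\in\mathbb{T}_\alpha$ or $M$ has no nonzero quotient in $\mathbb{T}_\alpha$. *)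

(* Defs.v *)
From HB Require Import structures.
From mathcomp Require Import all_boot all_algebra.

Set Implicit Arguments.
Unset Strict Implicit.
Unset Printing Implicit Defensive.

Import GRing.Theory.
Local Open Scope ring_scope.
Local Open Scope quotient_scope.

Section QuotientModule.
Variables (R : pzRingType) (M : lmodType R) (N : submodClosed M).

(* MathComp's [submodClosed] does not record closure under opposite; it follows
   from scaling by -1, and is needed to form the additive quotient. *)
Definition submod_pred : {pred M} := fun x => x \in N.

Fact submod_pred_zmod_closed : zmod_closed submod_pred.
Proof.
split; first exact: (rpred0 N).
by move=> x y xN yN; rewrite unfold_in rpredD// -scaleN1r rpredZ.
Qed.

HB.instance Definition _ :=
  GRing.isZmodClosed.Build M submod_pred submod_pred_zmod_closed.

Definition quotmod : Type := (Quotient.quot submod_pred).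

HB.instance Definition _ := GRing.Zmodule.on quotmod.

Definition quotmod_pi (x : M) : quotmod := \pi_(Quotient.quot submod_pred) x.

Definition quotmod_scale (a : R) (u : quotmod) : quotmod :=
  quotmod_pi (a *: repr (u : (Quotient.quot submod_pred))).

Fact quotmod_piD x y : quotmod_pi (x + y) = quotmod_pi x + quotmod_pi y.
Proof. exact: (raddfD \pi_(Quotient.quot submod_pred)). Qed.

Fact quotmod_pi_surj u : exists x, quotmod_pi x = u.
Proof. by exists (repr (u : (Quotient.quot submod_pred))); exact: reprK. Qed.

Fact quotmod_piP x y : reflect (quotmod_pi x = quotmod_pi y) (x - y \in N).
Proof.
have -> : (x - y \in N) = (x == y %[mod (Quotient.quot submod_pred)]).
  exact: (@Quotient.idealrBE M submod_pred x y).
exact: eqP.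
Qed.

Fact quotmod_piZ a x : quotmod_pi (a *: x) = quotmod_scale a (quotmod_pi x).
Proof.
apply/quotmod_piP; rewrite -scalerBr rpredZ//; apply/quotmod_piP.
by rewrite /quotmod_pi reprK.
Qed.

Fact quotmod_scaleA a b u :
  quotmod_scale a (quotmod_scale b u) = quotmod_scale (a * b) u.
Proof.
by have [x <-] := quotmod_pi_surj u; rewrite -!quotmod_piZ scalerA.
Qed.

Fact quotmod_scale1 : left_id 1 quotmod_scale.
Proof.
by move=> u; have [x <-] := quotmod_pi_surj u; rewrite -quotmod_piZ scale1r.
Qed.

Fact quotmod_scaleDr : right_distributive quotmod_scale +%R.
Proof.
move=> a u v; have [x <-] := quotmod_pi_surj u.
have [y <-] := quotmod_pi_surj v.
by rewrite -quotmod_piD -!quotmod_piZ scalerDr quotmod_piD.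
Qed.

Fact quotmod_scaleDl u : {morph quotmod_scale^~ u : a b / a + b}.
Proof.
move=> a b; have [x <-] := quotmod_pi_surj u.
by rewrite -!quotmod_piZ scalerDl quotmod_piD.
Qed.

HB.instance Definition _ := GRing.Zmodule_isLmodule.Build R quotmod
  quotmod_scaleA quotmod_scale1 quotmod_scaleDr quotmod_scaleDl.

Fact quotmod_pi_linear : linear quotmod_pi.
Proof. by move=> a x y; rewrite quotmod_piD quotmod_piZ. Qed.

HB.instance Definition _ :=
  GRing.isLinear.Build R M quotmod *:%R quotmod_pi quotmod_pi_linear.

End QuotientModule.

Section Preradicals.
Variable R : pzRingType.

(* On a homomorphism f the functor is the restriction of f, so functoriality
   amounts to the inclusion f(sigma(M)) <= sigma(N). *)
Record preradical := Preradical {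
  preradical_sub :> forall M : lmodType R, submodClosed M;
  preradical_morph : forall (M N : lmodType R) (f : {linear M -> N}) (x : M),
    x \in preradical_sub M -> f x \in preradical_sub N
}.

(* The product I M: all finite sums of r *: m with r in I and m in M. *)
Definition in_ideal_mul (I : {pred R}) (M : lmodType R) (x : M) : Prop :=
  exists (n : nat) (r : 'I_n -> R) (m : 'I_n -> M),
    (forall i, r i \in I) /\ x = \sum_(i < n) r i *: m i.

Definition t_radical (sigma : preradical) : Prop :=
  forall (M : lmodType R) (x : M),
    x \in sigma M <-> in_ideal_mul (sigma R^o) x.

Definition torsion_class (sigma : preradical) (M : lmodType R) : Prop :=
  sigma M =i predT.

Definition nonzero_module (M : lmodType R) : Prop := exists x : M, x != 0.

Definition second_module (A : preradical -> Prop) (M : lmodType R) : Prop :=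
  nonzero_module M /\
  forall alpha, A alpha -> alpha M =i pred1 (0 : M) \/ alpha M =i predT.

Definition cofirst_module (A : preradical -> Prop) (M : lmodType R) : Prop :=
  nonzero_module M /\
  forall alpha, A alpha ->
    torsion_class alpha M \/
    ~ (exists N : submodClosed M,
         nonzero_module (quotmod N) /\ torsion_class alpha (quotmod N)).

End Preradicals.

(* Main.v *)
Require Import Defs.
From mathcomp Require Import all_boot all_algebra.

Import GRing.Theory.
Local Open Scope ring_scope.

(** For a t-radical [alpha], the value [alpha M = alpha(R) M] vanishes exactly
when the ideal [alpha(R)] annihilates [M], and annihilation is inherited by
homomorphic images.  Hence, when [alpha M = 0], every quotient of [M] has zero
[alpha]-part, so the only quotient of [M] that is [alpha]-torsion is the zero
module.  The alternative allowed to a second module, [alpha M = M], is the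
torsion condition itself.  The argument is carried by
[t_radical_eq0_surj]. *)

(** Each product [r x] is a one-term sum in [sigma(R) M], so a module killed by
a t-radical is annihilated by the ideal [sigma(R)]. *)
Lemma t_radical_scale (R : pzRingType) (sigma : preradical R)
    (M : lmodType R) (r : R) (x : M) :
  t_radical sigma -> r \in sigma R^o -> r *: x \in sigma M.
Proof.
move=> tsigma rI; apply/tsigma.
by exists 1%N, (fun=> r), (fun=> x); split=> //; rewrite big_ord1.
Qed.

(** A preradical need not commute with surjections: [sigma L] may be larger than
the image of [sigma M].  For a t-radical, an element of [sigma L] is a
combination [sum r_i y_i] with [r_i] in [sigma(R)]; lifting each [y_i] to [M]
shows that it comes from [sigma M]. *)
Lemma t_radical_eq0_surj (R : pzRingType) (sigma : preradical R)
    (M L : lmodType R) (f : {linear M -> L}) :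
    t_radical sigma -> (forall y, exists x, f x = y) ->
  sigma M =i pred1 (0 : M) -> sigma L =i pred1 (0 : L).
Proof.
move=> tsigma f_surj sM0 y; rewrite inE.
apply/idP/eqP => [/tsigma [n [r [m [rI ->]]]] | ->]; last exact: rpred0.
apply: big1 => i _; have [x <-] := f_surj (m i).
have /eqP rx0 : r i *: x == 0.
  by have := t_radical_scale _ _ _ _ x tsigma (rI i); rewrite sM0 inE.
by rewrite -linearZ rx0 linear0.
Qed.

Theorem theorem5p3 (R : pzRingType) (A : preradical R -> Prop)
    (tA : forall alpha : preradical R, A alpha -> t_radical alpha)
    (M : lmodType R) :
  second_module A M -> cofirst_module A M.
Proof.
move=> [M_neq0 secM]; split=> // alpha Aalpha.
have [aM0 | aMT] := secM alpha Aalpha; last by left.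
right=> -[N [[u u_neq0] aQT]].
have aQ0 : alpha (quotmod N) =i pred1 0.
  exact: t_radical_eq0_surj (tA _ Aalpha) (@quotmod_pi_surj R M N) aM0.
by have := aQT u; rewrite aQ0 !inE (negPf u_neq0).
Qed.
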